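(* Let $A\in\mathbb{R}^{n\times n}$ be an invertible positive definite (not necessarily symmetric) matrix, i.e., there is $\delta>0$ with $\langle Ax,x\rangle\ge\delta|x|^2$ for all $x\in\mathbb{R}^n$. Write $A_s=\frac12(A+A^T)$, $A_a=\frac12(A-A^T)$ and $\tilde A=A^TA_s^{-1}A=A_s-A_aA_s^{-1}A_a$. Then $$\kappa(\tilde A)\le\min\{\kappa_1,\kappa_2\},$$ where $$\kappa_1:=\kappa(A_s)+\frac{\|A_a\|^2}{\lambda_{\min}(A_s)^2}\qquad\text{and}\qquad \kappa_2:=\kappa(A_s)\,\kappa(-A_a^2)+\frac{\lambda_{\max}(A_s)^2}{\lambda_{\min}(-A_a^2)}.$$
   Context: $\langle\cdot,\cdot\rangle$ and $|\cdot|$ are the Euclidean inner product and norm on $\mathbb{R}^n$, and $\|\cdot\|$ is the induced operator (spectral) norm on matrices. $\lambda_{\min}(S)$ and $\lambda_{\max}(S)$ denote the smallest and largest eigenvalues of a symmetric matrix $S$. The condition number of a matrix $B$ is $\kappa(B)=\|B\|\,\|B^{-1}\|$; for symmetric positive definite $B$ it equals $\lambda_{\max}(B)/\lambda_{\min}(B)$. *)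

(* Defs.v *)
From mathcomp Require Import all_boot all_order all_algebra.
From mathcomp Require Import all_classical all_reals.

Set Implicit Arguments.
Unset Strict Implicit.
Unset Printing Implicit Defensive.

Import Order.TTheory GRing.Theory Num.Theory.
Local Open Scope classical_set_scope.
Local Open Scope ring_scope.

(* Vectors of R^n are column vectors.  The library norm on matrices is the
   max norm, hence the Euclidean and spectral norms below. *)
Definition inner (R : realType) (n : nat) (x y : 'cV[R]_n) : R :=
  \sum_(i < n) x i 0 * y i 0.

Definition enorm (R : realType) (n : nat) (x : 'cV[R]_n) : R :=
  Num.sqrt (inner x x).

Definition opnorm (R : realType) (n : nat) (B : 'M[R]_n) : R :=
  sup [set enorm (B *m x) | x in [set x : 'cV[R]_n | enorm x <= 1]].

(* For symmetric S and 0 < n the set of real eigenvalues is finite and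
   nonempty, so that inf and sup are attained. *)
Definition lambda_min (R : realType) (n : nat) (S : 'M[R]_n) : R :=
  inf [set a : R | eigenvalue S a].

Definition lambda_max (R : realType) (n : nat) (S : 'M[R]_n) : R :=
  sup [set a : R | eigenvalue S a].

(* Singular matrices have infinite condition number. *)
Definition cond (R : realType) (n : nat) (B : 'M[R]_n) : \bar R :=
  if B \in unitmx then (opnorm B * opnorm (invmx B))%:E else +oo%E.

Definition sym_part (R : realType) (n : nat) (A : 'M[R]_n) : 'M[R]_n :=
  2^-1 *: (A + A^T).

Definition skew_part (R : realType) (n : nat) (A : 'M[R]_n) : 'M[R]_n :=
  2^-1 *: (A - A^T).

Definition tilde (R : realType) (n : nat) (A : 'M[R]_n) : 'M[R]_n :=
  A^T *m invmx (sym_part A) *m A.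

Definition kappa1 (R : realType) (n : nat) (A : 'M[R]_n) : \bar R :=
  (cond (sym_part A)
   + (opnorm (skew_part A) ^+ 2)%:E / (lambda_min (sym_part A) ^+ 2)%:E)%E.

(* The skew part may be singular (it always is for odd n).  Division in \bar R
   satisfies 0^-1 = +oo, so both summands, and kappa2, are then +oo, provided
   that the symmetric part is positive definite. *)
Definition kappa2 (R : realType) (n : nat) (A : 'M[R]_n) : \bar R :=
  (cond (sym_part A) * cond (- (skew_part A *m skew_part A))%R
   + (lambda_max (sym_part A) ^+ 2)%:E
     / (lambda_min (- (skew_part A *m skew_part A))%R)%:E)%E.

(* Main.v *)
Require Import Defs.
From mathcomp Require Import all_boot all_order all_algebra.
From mathcomp Require Import all_classical all_reals.
From mathcomp Require Import lra.

(* Let S and K be the symmetric and skew parts of A, so that tilde A = S + K^T S^-1 K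
   and |tilde A| <= |S| + |K|^2 |S^-1|.  If tilde A >= c > 0 as a quadratic form,
   then |(tilde A)^-1| <= 1/c.  Dropping the second summand gives c = lambda_min S,
   hence kappa1; dropping the first one and using S^-1 >= 1/|S| gives
   c = lambda_min (K^T K) / |S|, hence kappa2.  The spectral theorem is avoided:
   the infimum of the Rayleigh quotient of a symmetric matrix is shown directly
   to be an eigenvalue. *)

Import Order.TTheory GRing.Theory Num.Theory.
Local Open Scope ring_scope.

(** * Euclidean inner product and norm *)

Lemma inner_mx {R : realType} {n : nat} (x y : 'cV[R]_n) :
  inner x y = (x^T *m y) 0 0.
Proof. by rewrite /inner mxE; apply: eq_bigr => i _; rewrite mxE. Qed.

Lemma innerC {R : realType} {n : nat} (x y : 'cV[R]_n) : inner x y = inner y x.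
Proof. by apply: eq_bigr => i _; rewrite mulrC. Qed.

Lemma innerDl {R : realType} {n : nat} (x y z : 'cV[R]_n) :
  inner (x + y) z = inner x z + inner y z.
Proof. by rewrite !inner_mx linearD mulmxDl mxE. Qed.

Lemma innerZl {R : realType} {n : nat} (a : R) (x z : 'cV[R]_n) :
  inner (a *: x) z = a * inner x z.
Proof. by rewrite !inner_mx linearZ -scalemxAl mxE. Qed.

Lemma innerNl {R : realType} {n : nat} (x z : 'cV[R]_n) :
  inner (- x) z = - inner x z.
Proof. by rewrite -scaleN1r innerZl mulN1r. Qed.

Lemma innerBl {R : realType} {n : nat} (x y z : 'cV[R]_n) :
  inner (x - y) z = inner x z - inner y z.
Proof. by rewrite innerDl innerNl. Qed.

Lemma innerDr {R : realType} {n : nat} (x y z : 'cV[R]_n) :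
  inner z (x + y) = inner z x + inner z y.
Proof. by rewrite innerC innerDl !(innerC _ z). Qed.

Lemma innerZr {R : realType} {n : nat} (a : R) (x z : 'cV[R]_n) :
  inner z (a *: x) = a * inner z x.
Proof. by rewrite innerC innerZl innerC. Qed.

Lemma innerBr {R : realType} {n : nat} (x y z : 'cV[R]_n) :
  inner z (x - y) = inner z x - inner z y.
Proof. by rewrite innerC innerBl !(innerC _ z). Qed.

Lemma inner_mulmxl {R : realType} {n : nat} (B : 'M[R]_n) (x y : 'cV[R]_n) :
  inner (B *m x) y = inner x (B^T *m y).
Proof. by rewrite !inner_mx trmx_mul mulmxA. Qed.

Lemma inner_ge0 {R : realType} {n : nat} (x : 'cV[R]_n) : 0 <= inner x x.
Proof. by apply: sumr_ge0 => i _; rewrite -expr2 sqr_ge0. Qed.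

Lemma inner_eq0 {R : realType} {n : nat} (x : 'cV[R]_n) :
  (inner x x == 0) = (x == 0).
Proof.
apply/eqP/eqP => [xx0|->]; last by rewrite inner_mx mulmx0 mxE.
apply/colP => i; rewrite mxE; apply/eqP; rewrite -sqrf_eq0 expr2; apply/eqP.
by apply: (psumr_eq0P _ xx0) => // j _; rewrite -expr2 sqr_ge0.
Qed.

Lemma enorm_sqr {R : realType} {n : nat} (x : 'cV[R]_n) :
  enorm x ^+ 2 = inner x x.
Proof. exact: sqr_sqrtr (inner_ge0 x). Qed.

Lemma enorm_ge0 {R : realType} {n : nat} (x : 'cV[R]_n) : 0 <= enorm x.
Proof. exact: sqrtr_ge0. Qed.

Lemma enorm0 {R : realType} {n : nat} : enorm (0 : 'cV[R]_n) = 0.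
Proof. by rewrite /enorm inner_mx mulmx0 mxE sqrtr0. Qed.

Lemma enorm_gt0 {R : realType} {n : nat} (x : 'cV[R]_n) :
  (0 < enorm x) = (x != 0).
Proof. by rewrite sqrtr_gt0 lt0r inner_eq0 inner_ge0 andbT. Qed.

Lemma enormZ {R : realType} {n : nat} (a : R) (x : 'cV[R]_n) :
  enorm (a *: x) = `|a| * enorm x.
Proof.
by rewrite /enorm innerZl innerZr mulrA -expr2 sqrtrM ?sqr_ge0// sqrtr_sqr.
Qed.

Lemma enormN {R : realType} {n : nat} (x : 'cV[R]_n) : enorm (- x) = enorm x.
Proof. by rewrite -scaleN1r enormZ normrN1 mul1r. Qed.

Lemma inner_le_enorm {R : realType} {n : nat} (x y : 'cV[R]_n) :
  inner x y <= enorm x * enorm y.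
Proof.
have [->|x0] := eqVneq x 0; first by rewrite enorm0 mul0r inner_mx trmx0 mul0mx mxE.
have [->|y0] := eqVneq y 0; first by rewrite enorm0 mulr0 inner_mx mulmx0 mxE.
have ab_gt0 : 0 < enorm x * enorm y by rewrite mulr_gt0 ?enorm_gt0.
(* With a = |x| and b = |y|, the square |b x - a y|^2 equals 2ab (ab - <x, y>), and ab > 0. *)
have := inner_ge0 (enorm y *: x - enorm x *: y).
rewrite innerBl !innerBr !innerZl !innerZr (innerC y x) -!enorm_sqr => H.
rewrite -subr_ge0 -(pmulr_rge0 _ ab_gt0); nra.
Qed.

Lemma enormD {R : realType} {n : nat} (x y : 'cV[R]_n) :
  enorm (x + y) <= enorm x + enorm y.
Proof.
rewrite -ler_sqr ?nnegrE ?addr_ge0 ?enorm_ge0// enorm_sqr innerDl !innerDr.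
rewrite (innerC y x) -!enorm_sqr; have := inner_le_enorm x y; nra.
Qed.

(** * Operator norm *)

(** The crude constant, the sum of the row norms, serves only to bound the set whose [sup] is
    [opnorm], so that this [sup] is a genuine supremum. *)
Lemma mulmx_bounded {R : realType} {n : nat} (B : 'M[R]_n) :
  exists2 C : R, 0 <= C & forall x, enorm (B *m x) <= C * enorm x.
Proof.
have C_ge0 : 0 <= \sum_i enorm (row i B)^T.
  by apply: sumr_ge0 => i _; apply: enorm_ge0.
exists (\sum_i enorm (row i B)^T) => // x.
rewrite -ler_sqr ?nnegrE ?mulr_ge0 ?enorm_ge0// enorm_sqr.
have Bxi i : `|(B *m x) i 0| <= enorm (row i B)^T * enorm x.
  have -> : (B *m x) i 0 = inner (row i B)^T x.
    by rewrite inner_mx trmxK -row_mul [in RHS]mxE.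
  rewrite ler_norml inner_le_enorm andbT lerNl -innerNl.
  by rewrite -(enormN (row i B)^T) inner_le_enorm.
apply: (@le_trans _ _ (\sum_i (enorm (row i B)^T * enorm x) ^+ 2)).
  apply: ler_sum => i _; rewrite -expr2 -(real_normK (num_real _)).
  by rewrite ler_sqr ?nnegrE ?mulr_ge0 ?enorm_ge0.
(* The sum of squares of nonnegative terms is at most the square of their sum. *)
rewrite mulr_suml [leRHS]expr2 [leRHS]mulr_suml.
apply: ler_sum => i _; rewrite expr2 ler_wpM2l ?mulr_ge0 ?enorm_ge0//.
by rewrite [leRHS](bigD1 i)//= lerDl sumr_ge0// => j _; rewrite mulr_ge0 ?enorm_ge0.
Qed.

Lemma opnorm_ge0 {R : realType} {n : nat} (B : 'M[R]_n) : 0 <= opnorm B.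
Proof.
have [C C_ge0 HC] := mulmx_bounded B.
apply: ub_le_sup; last first.
  by exists 0; rewrite /= ?enorm0 ?ler01// mulmx0 enorm0.
exists C => _ [x /= x1 <-]; apply: le_trans (HC x) _; by apply: ler_piMr.
Qed.

Lemma enorm_mulmx {R : realType} {n : nat} (B : 'M[R]_n) (x : 'cV[R]_n) :
  enorm (B *m x) <= opnorm B * enorm x.
Proof.
have [->|x0] := eqVneq x 0; first by rewrite mulmx0 !enorm0 mulr0.
have [C C_ge0 HC] := mulmx_bounded B.
have x_gt0 : 0 < enorm x by rewrite enorm_gt0.
rewrite -ler_pdivrMr//; apply: ub_le_sup.
  by exists C => _ [y /= y1 <-]; apply: le_trans (HC y) _; apply: ler_piMr.
exists ((enorm x)^-1 *: x) => /=.
  by rewrite enormZ gtr0_norm ?invr_gt0// mulVf ?gt_eqF.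
by rewrite -scalemxAr enormZ gtr0_norm ?invr_gt0// mulrC.
Qed.

Lemma opnorm_le {R : realType} {n : nat} (B : 'M[R]_n) (C : R) : 0 <= C ->
  (forall x, enorm (B *m x) <= C * enorm x) -> opnorm B <= C.
Proof.
move=> C_ge0 HC; apply: ge_sup.
  by exists 0, 0; rewrite /= ?enorm0 ?ler01// mulmx0 enorm0.
by move=> _ [x /= x1 <-]; apply: le_trans (HC x) _; apply: ler_piMr.
Qed.

Lemma opnormD {R : realType} {n : nat} (B C : 'M[R]_n) :
  opnorm (B + C) <= opnorm B + opnorm C.
Proof.
apply: opnorm_le => [|x]; first by rewrite addr_ge0 ?opnorm_ge0.
rewrite mulmxDl mulrDl; apply: le_trans (enormD _ _) _.
by apply: lerD; apply: enorm_mulmx.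
Qed.

Lemma opnormN {R : realType} {n : nat} (B : 'M[R]_n) : opnorm (- B) <= opnorm B.
Proof.
by apply: opnorm_le => [|x]; rewrite ?opnorm_ge0// mulNmx enormN enorm_mulmx.
Qed.

Lemma opnormM {R : realType} {n : nat} (B C : 'M[R]_n) :
  opnorm (B *m C) <= opnorm B * opnorm C.
Proof.
apply: opnorm_le => [|x]; first by rewrite mulr_ge0 ?opnorm_ge0.
rewrite -mulmxA -mulrA; apply: le_trans (enorm_mulmx _ _) _.
by rewrite ler_wpM2l ?opnorm_ge0// enorm_mulmx.
Qed.

Lemma inner_mulmx_le {R : realType} {n : nat} (B : 'M[R]_n) (x : 'cV[R]_n) :
  inner (B *m x) x <= opnorm B * enorm x ^+ 2.
Proof.
apply: le_trans (inner_le_enorm _ _) _.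
by rewrite expr2 mulrA ler_wpM2r ?enorm_ge0 ?enorm_mulmx.
Qed.

(** * Coercive matrices *)

(** Neither symmetry of [B] nor positivity of [c] is built in: the notion applies to [A] and
    [tilde A] directly, and [coercive 0] is positive semidefiniteness. *)
Definition coercive {R : realType} {n : nat} (c : R) (B : 'M[R]_n) :=
  forall x : 'cV[R]_n, c * enorm x ^+ 2 <= inner (B *m x) x.

Lemma coercive_enorm {R : realType} {n : nat} (c : R) (B : 'M[R]_n) x :
  coercive c B -> c * enorm x <= enorm (B *m x).
Proof.
move=> cB; have [->|x0] := eqVneq x 0; first by rewrite mulmx0 !enorm0 mulr0.
rewrite -(ler_pM2r (x := enorm x)) ?enorm_gt0// -mulrA -expr2.
exact: le_trans (cB x) (inner_le_enorm _ _).
Qed.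

Lemma coercive_unit {R : realType} {n : nat} (c : R) (B : 'M[R]_n) :
  0 < c -> coercive c B -> B \in unitmx.
Proof.
(* Row freeness concerns kernels of row vectors, hence the passage to the transpose. *)
move=> c_gt0 cB; rewrite -unitmx_tr -row_free_unit.
apply: inj_row_free => v vB0.
have Bv0 : B *m v^T = 0 by apply: trmx_inj; rewrite trmx_mul trmxK vB0 trmx0.
have := coercive_enorm _ _ v^T cB.
rewrite Bv0 enorm0 pmulr_rle0// leNgt enorm_gt0 negbK => /eqP v0.
by apply: trmx_inj; rewrite v0 trmx0.
Qed.

(** The lower bound of [coercive_enorm] is applied at the preimage of [x] under [B]. *)
Lemma opnorm_invmx_le {R : realType} {n : nat} (c : R) (B : 'M[R]_n) :
  0 < c -> coercive c B -> opnorm (invmx B) <= c^-1.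
Proof.
move=> c_gt0 cB; apply: opnorm_le => [|x]; first by rewrite invr_ge0 ltW.
rewrite mulrC ler_pdivlMr// mulrC.
apply: le_trans (coercive_enorm _ _ _ cB) _.
by rewrite mulKVmx ?(coercive_unit c).
Qed.

(** * Eigenvalues of symmetric matrices *)

Lemma eigenvalue_sym {R : realType} {n : nat} (S : 'M[R]_n) (a : R) :
  S^T = S -> eigenvalue S a -> exists2 x : 'cV[R]_n, S *m x = a *: x & x != 0.
Proof.
(* [eigenvalue] refers to row eigenvectors; by symmetry their transposes are column eigenvectors. *)
move=> symS /eigenvalueP [v vS v0]; exists v^T; last first.
  by apply: contra_neq v0 => v0; apply: trmx_inj; rewrite v0 trmx0.
by apply: trmx_inj; rewrite trmx_mul symS trmxK linearZ/= trmxK.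
Qed.

Lemma coercive_le_eigenvalue {R : realType} {n : nat} (c : R) (S : 'M[R]_n) a :
  S^T = S -> coercive c S -> eigenvalue S a -> c <= a.
Proof.
move=> symS cS /(eigenvalue_sym _ _ symS) [x Sx x0]; have := cS x.
by rewrite Sx innerZl enorm_sqr ler_pM2r// lt0r inner_eq0 x0 inner_ge0.
Qed.

Lemma eigenvalue_norm_le {R : realType} {n : nat} (S : 'M[R]_n) a :
  S^T = S -> eigenvalue S a -> `|a| <= opnorm S.
Proof.
move=> symS /(eigenvalue_sym _ _ symS) [x Sx x0].
by have := enorm_mulmx S x; rewrite Sx enormZ ler_pM2r// enorm_gt0.
Qed.

(* Expand <P (x - t P x), x - t P x> >= 0 at t = 1 / C. *)
Lemma psd_enorm_sqr_le {R : realType} {n : nat} (P : 'M[R]_n) (C : R) x :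
  P^T = P -> coercive 0 P -> 0 < C -> opnorm P <= C ->
  enorm (P *m x) ^+ 2 <= C * inner (P *m x) x.
Proof.
move=> symP psdP C_gt0 PC; have := psdP (x - C^-1 *: (P *m x)).
rewrite mul0r mulmxBr -scalemxAr innerBl !innerBr !innerZl !innerZr.
rewrite (inner_mulmxl P (P *m x) x) symP -enorm_sqr.
have : inner (P *m (P *m x)) (P *m x) <= C * enorm (P *m x) ^+ 2.
  by apply: le_trans (inner_mulmx_le _ _) _; rewrite ler_wpM2r ?sqr_ge0.
set q := inner (P *m (P *m x)) _; set e := enorm _ ^+ 2; set p := inner _ x.
(* The expansion reads p - 2e/C + q/C^2 >= 0; bounding its last term by e/C leaves p >= e/C. *)
move=> qC H; have : C^-1 * (C^-1 * q) <= C^-1 * e.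
  by rewrite ler_pM2l ?invr_gt0// mulrC ler_pdivrMr// mulrC.
move=> H2; rewrite -ler_pdivrMl//; lra.
Qed.

(* The best coercivity constant m of S is an eigenvalue: otherwise S - m is
   positive semidefinite and invertible, hence coercive by [psd_enorm_sqr_le],
   and m could be increased. *)
Lemma sym_min_eigenvalue {R : realType} {n : nat} (S : 'M[R]_n) (c : R) :
  (0 < n)%N -> S^T = S -> coercive c S ->
  exists m : R, [/\ c <= m, eigenvalue S m & coercive m S].
Proof.
move=> n_gt0 symS cS; pose E := [set d : R | coercive d S]%classic.
have ubE : has_ubound E.
  exists (opnorm S) => d dS.
  have [x x0] : exists x : 'cV[R]_n, x != 0.
    exists (const_mx 1); apply/eqP => /colP/(_ (Ordinal n_gt0)).
    by rewrite !mxE => /eqP; rewrite oner_eq0.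
  have := le_trans (dS x) (inner_mulmx_le S x).
  by rewrite ler_pM2r// exprn_gt0// enorm_gt0.
have cm : c <= sup E by apply: ub_le_sup.
have mS : coercive (sup E) S.
  move=> x; have [->|x0] := eqVneq x 0.
    by rewrite enorm0 expr0n mulr0 inner_mx mulmx0 mxE.
  have x2 : 0 < enorm x ^+ 2 by rewrite exprn_gt0 ?enorm_gt0.
  rewrite -ler_pdivlMr//; apply: ge_sup; first by exists c.
  by move=> d dS; rewrite ler_pdivlMr.
exists (sup E); split => //; set m := sup E in mS cm *.
rewrite /eigenvalue /eigenspace kermx_eq0 row_free_unit; apply/negP => Punit.
set P := S - m%:M in Punit.
have symP : P^T = P by rewrite linearB/= symS tr_scalar_mx.
have PE x : inner (P *m x) x = inner (S *m x) x - m * enorm x ^+ 2.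
  by rewrite mulmxBl mul_scalar_mx innerBl innerZl -enorm_sqr.
have psdP : coercive 0 P by move=> x; rewrite mul0r PE subr_ge0.
(* Adding 1 makes both constants positive. From |x| <= D |P x| and |P x|^2 <= C <P x, x>, the matrix
   [P] is coercive with constant 1 / (C D^2). *)
pose C := opnorm P + 1; pose D := opnorm (invmx P) + 1.
have C_gt0 : 0 < C by rewrite ltr_wpDl ?opnorm_ge0.
have D_gt0 : 0 < D by rewrite ltr_wpDl ?opnorm_ge0.
have e_gt0 : 0 < (C * D ^+ 2)^-1 by rewrite invr_gt0 mulr_gt0 ?exprn_gt0.
suff : E (m + (C * D ^+ 2)^-1).
  by move=> /(ub_le_sup ubE); rewrite leNgt ltrDl e_gt0.
move=> x; rewrite mulrDl addrC -lerBrDr -PE ler_pdivrMl ?mulr_gt0 ?exprn_gt0//.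
have xD : enorm x <= D * enorm (P *m x).
  rewrite -{1}[x](mulKmx Punit); apply: le_trans (enorm_mulmx _ _) _.
  by rewrite ler_wpM2r ?enorm_ge0// lerDl.
apply: (@le_trans _ _ ((D * enorm (P *m x)) ^+ 2)).
  by rewrite ler_sqr// nnegrE ?mulr_ge0 ?enorm_ge0// ltW.
rewrite exprMn [leRHS]mulrAC [leRHS]mulrC ler_wpM2l ?sqr_ge0//.
by apply: psd_enorm_sqr_le => //; rewrite lerDl.
Qed.

(** Every coercivity constant is below every eigenvalue, so an eigenvalue that is itself such a
    constant is the smallest one. *)
Lemma lambda_min_coercive {R : realType} {n : nat} (S : 'M[R]_n) (c : R) :
  (0 < n)%N -> S^T = S -> coercive c S ->
  [/\ c <= lambda_min S, eigenvalue S (lambda_min S) & coercive (lambda_min S) S].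
Proof.
move=> n_gt0 symS cS; have [m [cm mS mcS]] := sym_min_eigenvalue _ _ n_gt0 symS cS.
suff -> : lambda_min S = m by [].
have lbm : lbound [set a | eigenvalue S a]%classic m.
  by move=> a; apply: coercive_le_eigenvalue.
apply/eqP; rewrite eq_le lb_le_inf ?andbT//; last by exists m.
by apply: ge_inf => //; exists m.
Qed.

(** * Inverse and norm of a symmetric positive definite matrix *)

Lemma invmx_eigenvalue {R : realType} {n : nat} (S : 'M[R]_n) (a : R) :
  S \in unitmx -> eigenvalue S a -> eigenvalue (invmx S) a^-1.
Proof.
move=> Sunit /eigenvalueP [v vS v0]; apply/eigenvalueP; exists v => //.
have a0 : a != 0.
  apply: contra_neq v0 => a0.
  by rewrite -[v](mulmxK Sunit) vS a0 scale0r mul0mx.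
apply: (scalerI a0); rewrite scalerA mulfV// scale1r.
by rewrite scalemxAl -vS mulmxK.
Qed.

Lemma invmx_sym {R : realType} {n : nat} (S : 'M[R]_n) :
  S^T = S -> (invmx S)^T = invmx S.
Proof. by move=> symS; rewrite trmx_inv symS. Qed.

(** Coercivity gives the upper bound; the lower one holds since 1 / [lambda_min S] is an eigenvalue
    of the inverse. *)
Lemma opnorm_invmx_spd {R : realType} {n : nat} (S : 'M[R]_n) (c : R) :
  (0 < n)%N -> S^T = S -> 0 < c -> coercive c S ->
  opnorm (invmx S) = (lambda_min S)^-1.
Proof.
move=> n_gt0 symS c_gt0 cS.
have [cm mS mcS] := lambda_min_coercive _ _ n_gt0 symS cS.
have m_gt0 := lt_le_trans c_gt0 cm.
apply/eqP; rewrite eq_le opnorm_invmx_le//=.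
apply: le_trans (ler_norm _) _; apply: eigenvalue_norm_le; first exact: invmx_sym.
by apply: invmx_eigenvalue => //; apply: coercive_unit cS.
Qed.

Lemma opnorm_gt0 {R : realType} {n : nat} (B : 'M[R]_n) :
  (0 < n)%N -> B \in unitmx -> 0 < opnorm B.
Proof.
move=> n_gt0 Bunit; rewrite lt0r opnorm_ge0 andbT; apply/negP => /eqP B0.
have := enorm_mulmx B (invmx B *m const_mx 1).
rewrite B0 mul0r mulKVmx// leNgt enorm_gt0 => /negP; apply.
apply/eqP => /colP/(_ (Ordinal n_gt0)).
by rewrite !mxE => /eqP; rewrite oner_eq0.
Qed.

(** For y = S x the claim becomes |S x|^2 <= |S| <S x, x>, which is [psd_enorm_sqr_le]. *)
Lemma coercive_invmx {R : realType} {n : nat} (S : 'M[R]_n) (c : R) :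
  (0 < n)%N -> S^T = S -> 0 < c -> coercive c S ->
  coercive (opnorm S)^-1 (invmx S).
Proof.
move=> n_gt0 symS c_gt0 cS; have Sunit := coercive_unit _ _ c_gt0 cS.
have S_gt0 := opnorm_gt0 _ n_gt0 Sunit.
move=> y; rewrite ler_pdivrMl// -{1}(mulKVmx Sunit y) -{3}(mulKVmx Sunit y).
rewrite (innerC _ (S *m _)).
apply: psd_enorm_sqr_le => // x; rewrite mul0r.
by apply: le_trans (cS x); rewrite mulr_ge0 ?sqr_ge0 ?ltW.
Qed.

(** Applying [opnorm_invmx_spd] to the inverse of [S] shows that |S| is an eigenvalue of [S]; no
    eigenvalue exceeds |S|. *)
Lemma opnorm_spd {R : realType} {n : nat} (S : 'M[R]_n) (c : R) :
  (0 < n)%N -> S^T = S -> 0 < c -> coercive c S -> opnorm S = lambda_max S.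
Proof.
move=> n_gt0 symS c_gt0 cS; have Sunit := coercive_unit _ _ c_gt0 cS.
have S_gt0 := opnorm_gt0 _ n_gt0 Sunit.
have Vgt0 : 0 < (opnorm S)^-1 by rewrite invr_gt0.
have cV := coercive_invmx _ _ n_gt0 symS c_gt0 cS.
have [_ mV _] := lambda_min_coercive _ _ n_gt0 (invmx_sym _ symS) cV.
have := opnorm_invmx_spd _ _ n_gt0 (invmx_sym _ symS) Vgt0 cV.
rewrite invmxK => SE.
have Seig : eigenvalue S (opnorm S).
  by rewrite SE -{1}(invmxK S); apply: invmx_eigenvalue; rewrite ?unitmx_inv.
have ubS : ubound [set a | eigenvalue S a]%classic (opnorm S).
  by move=> a aS; apply: le_trans (ler_norm a) _; apply: eigenvalue_norm_le.
apply/eqP; rewrite eq_le; apply/andP; split.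
  by apply: ub_le_sup => //; exists (opnorm S).
by apply: ge_sup => //; exists (opnorm S).
Qed.

(** Both bounds on [cond (tilde A)] come from here, with the same [C] and different [c]. *)
Lemma cond_coercive_le {R : realType} {n : nat} (B : 'M[R]_n) (c C : R) :
  0 < c -> coercive c B -> opnorm B <= C -> (cond B <= (C / c)%:E)%E.
Proof.
move=> c_gt0 cB BC; rewrite /cond (coercive_unit c)// lee_fin.
by apply: ler_pM; rewrite ?opnorm_ge0// opnorm_invmx_le.
Qed.

(** * Symmetric and skew parts *)

Lemma sym_part_sym {R : realType} {n : nat} (A : 'M[R]_n) :
  (sym_part A)^T = sym_part A.
Proof. by rewrite /sym_part linearZ/= linearD/= trmxK addrC. Qed.

Lemma skew_part_skew {R : realType} {n : nat} (A : 'M[R]_n) :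
  (skew_part A)^T = - skew_part A.
Proof. by rewrite /skew_part linearZ/= linearB/= trmxK -scalerN opprB. Qed.

Lemma sym_skew_part {R : realType} {n : nat} (A : 'M[R]_n) :
  A = sym_part A + skew_part A.
Proof.
rewrite /sym_part /skew_part -scalerDr addrACA subrr addr0 -mulr2n.
by rewrite -scaler_nat scalerA mulVf ?scale1r// pnatr_eq0.
Qed.

Lemma tr_sym_skew_part {R : realType} {n : nat} (A : 'M[R]_n) :
  A^T = sym_part A - skew_part A.
Proof.
by rewrite {1}(sym_skew_part A) linearD/= sym_part_sym skew_part_skew.
Qed.

Lemma inner_skew {R : realType} {n : nat} (K : 'M[R]_n) (x : 'cV[R]_n) :
  K^T = - K -> inner (K *m x) x = 0.
Proof.
move=> skewK; have := inner_mulmxl K x x.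
rewrite skewK mulNmx (innerC x) innerNl; lra.
Qed.

Lemma inner_skew_sqr {R : realType} {n : nat} (K : 'M[R]_n) (x : 'cV[R]_n) :
  K^T = - K -> inner (- (K *m K) *m x) x = enorm (K *m x) ^+ 2.
Proof.
move=> skewK.
by rewrite -mulNmx -mulmxA -skewK inner_mulmxl trmxK enorm_sqr.
Qed.

Lemma skew_sqr_sym {R : realType} {n : nat} (K : 'M[R]_n) :
  K^T = - K -> (- (K *m K))^T = - (K *m K).
Proof. by move=> skewK; rewrite linearN/= trmx_mul skewK mulNmx mulmxN opprK. Qed.

(** Since |K x|^2 = <-K^2 x, x>, the square root of |-K^2| bounds [K]. *)
Lemma opnorm_skew_sqr {R : realType} {n : nat} (K : 'M[R]_n) :
  K^T = - K -> opnorm K ^+ 2 <= opnorm (- (K *m K)).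
Proof.
move=> skewK; rewrite -[leRHS]sqr_sqrtr ?opnorm_ge0//.
rewrite ler_sqr ?nnegrE ?opnorm_ge0 ?sqrtr_ge0//.
apply: opnorm_le => [|x]; first exact: sqrtr_ge0.
rewrite -ler_sqr ?nnegrE ?mulr_ge0 ?sqrtr_ge0 ?enorm_ge0//.
by rewrite exprMn (sqr_sqrtr (opnorm_ge0 _)) -inner_skew_sqr// inner_mulmx_le.
Qed.

Lemma coercive_skew_sqr {R : realType} {n : nat} (K : 'M[R]_n) :
  K^T = - K -> coercive 0 (- (K *m K)).
Proof. by move=> skewK x; rewrite mul0r inner_skew_sqr// sqr_ge0. Qed.

(** * The matrix [tilde A] *)

Lemma tildeE {R : realType} {n : nat} (A : 'M[R]_n) :
  sym_part A \in unitmx ->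
  tilde A = sym_part A - skew_part A *m invmx (sym_part A) *m skew_part A.
Proof.
(* In (S - K) S^-1 (S + K) the two cross terms are K and -K and cancel. *)
move=> Sunit; rewrite /tilde tr_sym_skew_part {4}(sym_skew_part A).
rewrite mulmxBl mulmxV// mulmxBl !mulmxDr !mul1mx mulmxKV//.
by rewrite opprD addrA addrK.
Qed.

Lemma inner_tilde {R : realType} {n : nat} (A : 'M[R]_n) (x : 'cV[R]_n) :
  sym_part A \in unitmx ->
  inner (tilde A *m x) x = inner (sym_part A *m x) x
    + inner (invmx (sym_part A) *m (skew_part A *m x)) (skew_part A *m x).
Proof.
move=> Sunit; rewrite tildeE// mulmxBl innerBl; congr (_ + _).
by rewrite -innerNl -!mulmxA -mulNmx -skew_part_skew inner_mulmxl trmxK.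
Qed.

Lemma opnorm_tilde {R : realType} {n : nat} (A : 'M[R]_n) :
  sym_part A \in unitmx ->
  opnorm (tilde A) <= opnorm (sym_part A)
    + opnorm (skew_part A) ^+ 2 * opnorm (invmx (sym_part A)).
Proof.
move=> Sunit; rewrite tildeE//; apply: le_trans (opnormD _ _) _.
rewrite lerD2l; apply: le_trans (opnormN _) _; apply: le_trans (opnormM _ _) _.
by rewrite expr2 mulrAC ler_wpM2r ?opnorm_ge0 ?opnormM.
Qed.

(** The skew part contributes nothing to the quadratic form of [A]. *)
Lemma sym_part_coercive {R : realType} {n : nat} (A : 'M[R]_n) (c : R) :
  coercive c A -> coercive c (sym_part A).
Proof.
move=> cA x; apply: le_trans (cA x) _.
rewrite {1}(sym_skew_part A) mulmxDl innerDl.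
by rewrite (inner_skew (skew_part A))// ?addr0 ?skew_part_skew.
Qed.

(** * The two bounds on the condition number *)

Lemma cond_tilde_le_kappa1 {R : realType} {n : nat} (A : 'M[R]_n) (c : R) :
  (0 < n)%N -> 0 < c -> coercive c A -> (cond (tilde A) <= kappa1 A)%E.
Proof.
move=> n_gt0 c_gt0 /sym_part_coercive cS; have symS := sym_part_sym A.
have Sunit := coercive_unit _ _ c_gt0 cS.
have [cm _ mS] := lambda_min_coercive _ _ n_gt0 symS cS.
have SV := opnorm_invmx_spd _ _ n_gt0 symS c_gt0 cS.
have m_gt0 := lt_le_trans c_gt0 cm.
have cV := coercive_invmx _ _ n_gt0 symS c_gt0 cS.
have tilde_coercive : coercive (lambda_min (sym_part A)) (tilde A).
  move=> x; rewrite inner_tilde//; apply: le_trans (mS x) _.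
  rewrite lerDl; apply: le_trans (cV _).
  by rewrite mulr_ge0 ?sqr_ge0 ?invr_ge0 ?opnorm_ge0.
apply: le_trans (cond_coercive_le _ _ _ m_gt0 tilde_coercive (opnorm_tilde _ Sunit)) _.
(* With |S^-1| = 1 / [lambda_min S], the bound obtained is exactly [kappa1 A]. *)
rewrite /kappa1 /cond Sunit inver sqrf_eq0 gt_eqF// -EFinM -EFinD lee_fin SV.
by rewrite mulrDl -mulrA -invfM -expr2.
Qed.

Lemma cond_tilde_le_kappa2 {R : realType} {n : nat} (A : 'M[R]_n) (c : R) :
  (0 < n)%N -> 0 < c -> coercive c A -> (cond (tilde A) <= kappa2 A)%E.
Proof.
move=> n_gt0 c_gt0 /sym_part_coercive cS; have symS := sym_part_sym A.
have Sunit := coercive_unit _ _ c_gt0 cS.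
have SVunit : invmx (sym_part A) \in unitmx by rewrite unitmx_inv.
have skewK := skew_part_skew A; have symK2 := skew_sqr_sym _ skewK.
have [m_ge0 mK mK2] :=
  lambda_min_coercive _ _ n_gt0 symK2 (coercive_skew_sqr _ skewK).
have S_gt0 := opnorm_gt0 _ n_gt0 Sunit.
have SV_gt0 := opnorm_gt0 _ n_gt0 SVunit.
rewrite /kappa2 -(opnorm_spd _ _ n_gt0 symS c_gt0 cS) {2}/cond Sunit.
set K2 := - (skew_part A *m skew_part A) in symK2 m_ge0 mK mK2 *.
set m := lambda_min K2 in m_ge0 mK mK2 *.
(* If [K2] is singular, the first summand of [kappa2] is a positive number times +oo and the second
   is nonnegative, so the bound is +oo. *)
have [K2unit|K2sing] := boolP (K2 \in unitmx); last first.
  rewrite {2}/cond (negbTE K2sing) gt0_muley ?lte_fin ?mulr_gt0//.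
  rewrite addye ?leey// gt_eqF// (@lt_le_trans _ _ 0%E) ?ltNy0//.
  by rewrite mule_ge0 ?inve_ge0 ?lee_fin ?sqr_ge0.
(* [m] is an eigenvalue, and 0 is not an eigenvalue of an invertible matrix. *)
have m_gt0 : 0 < m.
  rewrite lt0r m_ge0 andbT; apply: contraL K2unit => /eqP m0.
  move: mK; rewrite m0 /eigenvalue /eigenspace kermx_eq0 row_free_unit.
  by rewrite raddf0 subr0.
rewrite {2}/cond K2unit inver gt_eqF// -!EFinM -EFinD.
have cV := coercive_invmx _ _ n_gt0 symS c_gt0 cS.
have c'_gt0 : 0 < m / opnorm (sym_part A) by rewrite divr_gt0.
have tilde_coercive : coercive (m / opnorm (sym_part A)) (tilde A).
  move=> x; rewrite inner_tilde//; apply: ler_wpDl.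
    by apply: le_trans (cS x); rewrite mulr_ge0 ?sqr_ge0 ?ltW.
  apply: le_trans (cV _); rewrite mulrAC mulrC ler_wpM2l ?invr_ge0 ?opnorm_ge0//.
  by rewrite -inner_skew_sqr.
apply: le_trans (cond_coercive_le _ _ _ c'_gt0 tilde_coercive (opnorm_tilde _ Sunit)) _.
rewrite lee_fin (opnorm_invmx_spd _ _ n_gt0 symK2 m_gt0 mK2) -/m.
(* In (|S| + |K|^2 |S^-1|) |S| / m the first term is the second summand of [kappa2]; the other is
   compared with the first summand through |K|^2 <= |K2|. *)
rewrite invf_div mulrDl addrC lerD//; last by rewrite mulrA expr2.
rewrite !mulrA ler_wpM2r ?invr_ge0// [leRHS]mulrC -mulrA [X in _ * X]mulrC.
by rewrite ler_wpM2r ?mulr_ge0 ?opnorm_ge0// opnorm_skew_sqr.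
Qed.

Theorem proposition2p2 (R : realType) (n : nat) (A : 'M[R]_n)
    (n_gt0 : (0 < n)%N)
    (A_unit : A \in unitmx)
    (A_posdef : exists2 delta : R, 0 < delta &
       forall x : 'cV[R]_n, delta * enorm x ^+ 2 <= inner (A *m x) x) :
  tilde A = sym_part A - skew_part A *m invmx (sym_part A) *m skew_part A
  /\ (cond (tilde A) <= Order.min (kappa1 A) (kappa2 A))%E.
Proof.
have [delta delta_gt0 cA] := A_posdef; split.
  by apply/tildeE/(coercive_unit _ _ delta_gt0)/sym_part_coercive.
by rewrite le_min (cond_tilde_le_kappa1 _ delta) ?(cond_tilde_le_kappa2 _ delta).
Qed.
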